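(* Let $\mathsf P$ be a finite poset, let $(\mathcal X,\nu)$ be a $\mathsf P$-graded cell complex over a field $\mathbb K$, and let $\mathsf L=\mathsf O(\mathsf P)$ be the lattice of down-sets of $\mathsf P$. If $(C',\pi)$ is a Conley complex for the associated $\mathsf P$-graded chain complex $(C(\mathcal X),\pi^\nu)$, then $(C',\pi)$ is a Conley complex for the associated $\mathsf L$-filtered chain complex $(C(\mathcal X),f^\nu)$.
   Context: Vector spaces are finite-dimensional over $\mathbb K$. Cell complex: a finite poset $(\mathcal X,\leq)$ with an order-preserving $\dim\colon\mathcal X\to\mathbb N$ and $\kappa\colon\mathcal X\times\mathcal X\to\mathbb K$ such that $\kappa(\xi,\xi')\neq0$ implies $\xi'\leq\xi$ and $\dim\xi=\dim\xi'+1$, and $\sum_{\xi'}\kappa(\xi,\xi')\kappa(\xi',\xi'')=0$. $C_n(\mathcal X)$ has basis the $n$-dimensional cells, $\partial\xi=\sum_{\xi'}\kappa(\xi,\xi')\xi'$. A $\mathsf P$-graded cell complex is a cell complex with an order-preserving $\nu\colon(\mathcal X,\leq)\to\mathsf P$. $\pi^\nu$ consists of the projections $C_j(\mathcal X)\to C_j(\nu^{-1}(p))$. A $\mathsf P$-graded vector space is $V$ with idempotents $\pi^p$ ($p\in\mathsf P$), $\sum_p\pi^p=\mathrm{id}$, $\pi^p\pi^q=0$ for $p\neq q$; $V^p=\operatorname{im}\pi^p$. A linear map $\phi$ is $\mathsf P$-filtered if $\phi^{pq}:=\pi^p\phi\pi^q\neq0$ implies $p\leq q$. A $\mathsf P$-graded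 chain complex is a $\mathbb Z$-indexed chain complex of $\mathsf P$-graded vector spaces with $\mathsf P$-filtered boundary maps. $\mathsf P$-filtered chain equivalence: $\mathsf P$-filtered chain maps in both directions, inverse up to $\mathsf P$-filtered chain homotopies. A Conley complex for a $\mathsf P$-graded chain complex $(C,\pi)$ is a $\mathsf P$-graded chain complex $(C',\pi)$ that is strict ($\partial_j'^{pp}=0$ for all $p,j$) and $\mathsf P$-filtered chain equivalent to $(C,\pi)$. An $\mathsf L$-filtered chain complex $(C,f)$ is a chain complex with lattice homomorphisms (preserving $0,1$) $f_n\colon\mathsf L\to\mathsf{Sub}(C_n)$ into the lattice of subspaces (operations $\cap,+$) such that $\partial_n(f_n(a))\subseteq f_{n-1}(a)$ for all $a$. A linear map is $\mathsf L$-filtered if it carries the subspace indexed by $a$ into the subspace indexed by $a$ for all $a\in\mathsf L$; $\mathsf L$-filtered chain equivalence is defined with $\mathsf L$-filtered chain maps and $\mathsf L$-filtered chain homotopies. $f^\nu(a)=\operatorname{span}\nu^{-1}(a)$ for $a\in\mathsf O(\mathsf P)$. For a $\mathsf P$-graded chain complex $(C',\pi)$, $\mathfrak L(C',\pi)$ is the $\mathsf O(\mathsf P)$-filtered chain complex $C'$ with filtering $a\mapsto\bigoplus_{p\in a}C'^p$. A $\mathsf P$-graded chain complex $(C',\pi)$ is a Conley complex for an $\mathsf L$-filtered chain complex $(C,f)$ if it is strict and $\mathfrak L(C',\pi)$ is $\mathsf L$-filtered chain equivalent to $(C,f)$. *)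

(* Defs.v *)
From HB Require Import structures.
From mathcomp Require Import all_boot all_order all_algebra.

Set Implicit Arguments.
Unset Strict Implicit.
Unset Printing Implicit Defensive.

Import Order.TTheory GRing.Theory.
Import Order.DefaultSetSubsetOrder.
Local Open Scope ring_scope.

(* O(P) is a bounded sublattice of the lattice of all subsets of P ordered by
   inclusion: meet is intersection, join is union. *)
Section DownSets.
Context {d : Order.disp_t} (P : finPOrderType d).

Definition is_downset (A : {set P}) : bool :=
  [forall p, forall q, (p \in A) && (q <= p)%O ==> (q \in A)].

Lemma is_downsetP (A : {set P}) :
  reflect (forall p q, p \in A -> (q <= p)%O -> q \in A) (is_downset A).
Proof.
apply: (iffP forallP) => [H p q pA qp|H p].
  by move/forallP/(_ q)/implyP: (H p); apply; rewrite pA.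
by apply/forallP => q; apply/implyP => /andP[]; apply: H.
Qed.

Record downset := Downset { dset :> {set P}; _ : is_downset dset }.

HB.instance Definition _ := [isSub for dset].
HB.instance Definition _ := [Finite of downset by <:].

Lemma downset_meet_closed : Order.ClosedPredicates.meet_closed (is_downset : {pred {set P}}).
Proof.
move=> A B /is_downsetP hA /is_downsetP hB; apply/is_downsetP => p q.
rewrite !inE => /andP[pA pB] qp.
by rewrite (hA p q) // (hB p q).
Qed.

Lemma downset_join_closed : Order.ClosedPredicates.join_closed (is_downset : {pred {set P}}).
Proof.
move=> A B /is_downsetP hA /is_downsetP hB; apply/is_downsetP => p q.
rewrite !inE => /orP[pA|pB] qp.
  by rewrite (hA p q).
by rewrite (hB p q) ?orbT.
Qed.

Lemma downset_bot : \bot%O \in (is_downset : {pred {set P}}).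
Proof. by apply/is_downsetP => p q; rewrite inE. Qed.

Lemma downset_top : \top%O \in (is_downset : {pred {set P}}).
Proof. by apply/is_downsetP => p q; rewrite !inE. Qed.

Fact downset_display : Order.disp_t. Proof. exact: Order.Disp tt tt. Qed.

HB.instance Definition _ :=
  Order.SubChoice_isTBSubLattice.Build _ {set P} _ downset_display downset
    downset_meet_closed downset_join_closed downset_bot downset_top.
End DownSets.

Lemma in_downsetI d (P : finPOrderType d) (a b : downset P) p :
  (p \in (a `&` b)%O) = (p \in a) && (p \in b).
Proof. by rewrite -in_setI. Qed.

Lemma in_downsetU d (P : finPOrderType d) (a b : downset P) p :
  (p \in (a `|` b)%O) = (p \in a) || (p \in b).
Proof. by rewrite -in_setU. Qed.

Lemma in_downset0 d (P : finPOrderType d) p :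
  (p \in (\bot%O : downset P)) = false.
Proof. by rewrite -(in_set0 p). Qed.

Lemma in_downset1 d (P : finPOrderType d) p : p \in (\top%O : downset P).
Proof. exact: in_setT. Qed.

Lemma downset_le d (P : finPOrderType d) (a : downset P) p q :
  p \in a -> (q <= p)%O -> q \in a.
Proof. exact: (is_downsetP _ (valP a)). Qed.

(* Chain complexes are indexed by all integers. [bnd n] is the boundary map
   usually written $\partial_{n+1}$; with this shift no cast between C_{n-1+1}
   and C_n is needed, and since [n] ranges over [int] every degree is covered. *)
Record chain_complex (K : fieldType) := ChainComplex {
  chains :> int -> vectType K;
  bnd : forall n, 'Hom(chains (n + 1), chains n);
  bnd_bnd : forall n, (bnd n \o bnd (n + 1) = 0)%VF
}.

Section ChainMaps.
Context {K : fieldType}.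
Implicit Types C D : chain_complex K.

Definition is_chain_map C D (phi : forall n, 'Hom(C n, D n)) : Prop :=
  forall n, (phi n \o bnd C n = bnd D n \o phi (n + 1))%VF.

Definition is_chain_homotopy C D (phi psi : forall n, 'Hom(C n, D n))
    (h : forall n, 'Hom(C n, D (n + 1))) : Prop :=
  forall n, psi (n + 1) - phi (n + 1) =
    ((bnd D (n + 1) \o h (n + 1)) + (h n \o bnd C n))%VF.

End ChainMaps.

Record grading d (P : finPOrderType d) (K : fieldType) (V : vectType K) :=
  Grading {
    gproj :> P -> 'End(V);
    gproj_idem : forall p, (gproj p \o gproj p = gproj p)%VF;
    gproj_sum : \sum_p gproj p = \1%VF;
    gproj_orth : forall p q, p != q -> (gproj p \o gproj q = 0)%VF
  }.

Definition graded_filtered d (P : finPOrderType d) (K : fieldType)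
    (V W : vectType K) (piV : grading P V) (piW : grading P W)
    (phi : 'Hom(V, W)) : Prop :=
  forall p q, (piW p \o phi \o piV q)%VF != 0 -> (p <= q)%O.

Record graded_complex d (P : finPOrderType d) (K : fieldType) :=
  GradedComplex {
    gcomplex :> chain_complex K;
    gpi : forall n, grading P (gcomplex n);
    gbnd_filtered : forall n,
      graded_filtered (gpi (n + 1)) (gpi n) (bnd gcomplex n)
  }.

Section GradedComplexes.
Context {d : Order.disp_t} {P : finPOrderType d} {K : fieldType}.
Implicit Types C D : graded_complex P K.

Definition strict C : Prop :=
  forall p n, (gpi C n p \o bnd C n \o gpi C (n + 1) p = 0)%VF.

Definition graded_chain_equivalent C D : Prop :=
  exists (phi : forall n, 'Hom(C n, D n)) (psi : forall n, 'Hom(D n, C n))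
         (g : forall n, 'Hom(C n, C (n + 1)))
         (h : forall n, 'Hom(D n, D (n + 1))),
    [/\ is_chain_map phi /\
          (forall n, graded_filtered (gpi C n) (gpi D n) (phi n)),
        is_chain_map psi /\
          (forall n, graded_filtered (gpi D n) (gpi C n) (psi n)),
        is_chain_homotopy (fun n => psi n \o phi n)%VF (fun n => \1%VF) g /\
          (forall n, graded_filtered (gpi C n) (gpi C (n + 1)) (g n)) &
        is_chain_homotopy (fun n => phi n \o psi n)%VF (fun n => \1%VF) h /\
          (forall n, graded_filtered (gpi D n) (gpi D (n + 1)) (h n))].

Definition graded_conley_complex C C' : Prop :=
  strict C' /\ graded_chain_equivalent C' C.

End GradedComplexes.

(* The lattice of subspaces of V is [{vspace V}] with meet [:&:], join [+],
   bottom [0] and top [fullv]. *)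
Record is_subspace_lattice_hom dL (L : tbLatticeType dL) (K : fieldType)
    (V : vectType K) (f : L -> {vspace V}) : Prop := IsSubspaceLatticeHom {
  slh_bot : f \bot%O = 0%VS;
  slh_top : f \top%O = fullv;
  slh_meet : forall a b, f (a `&` b)%O = (f a :&: f b)%VS;
  slh_join : forall a b, f (a `|` b)%O = (f a + f b)%VS
}.

Record filtered_complex dL (L : tbLatticeType dL) (K : fieldType) :=
  FilteredComplex {
    fcomplex :> chain_complex K;
    filt : forall n, L -> {vspace fcomplex n};
    filt_hom : forall n, is_subspace_lattice_hom (filt n);
    filt_bnd : forall n a,
      (bnd fcomplex n @: filt (n + 1) a <= filt n a)%VS
  }.

Arguments filt {dL L K} _ n a.

Definition lattice_filtered dL (L : tbLatticeType dL) (K : fieldType)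
    (V W : vectType K) (f : L -> {vspace V}) (g : L -> {vspace W})
    (phi : 'Hom(V, W)) : Prop :=
  forall a, (phi @: f a <= g a)%VS.

Definition filtered_chain_equivalent dL (L : tbLatticeType dL) (K : fieldType)
    (C D : filtered_complex L K) : Prop :=
  exists (phi : forall n, 'Hom(C n, D n)) (psi : forall n, 'Hom(D n, C n))
         (g : forall n, 'Hom(C n, C (n + 1)))
         (h : forall n, 'Hom(D n, D (n + 1))),
    [/\ is_chain_map phi /\
          (forall n, lattice_filtered (filt C n) (filt D n) (phi n)),
        is_chain_map psi /\
          (forall n, lattice_filtered (filt D n) (filt C n) (psi n)),
        is_chain_homotopy (fun n => psi n \o phi n)%VF (fun n => \1%VF) g /\
          (forall n,
             lattice_filtered (filt C n) (filt C (n + 1)) (g n)) &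
        is_chain_homotopy (fun n => phi n \o psi n)%VF (fun n => \1%VF) h /\
          (forall n,
             lattice_filtered (filt D n) (filt D (n + 1)) (h n))].

Section DownsetFiltering.
Context {d : Order.disp_t} {P : finPOrderType d} {K : fieldType}.

(* The sum is direct because the projections are orthogonal idempotents. *)
Definition grading_filt (V : vectType K) (pi : grading P V) (a : downset P) :
    {vspace V} :=
  (\sum_(p in a) limg (pi p))%VS.

Lemma grading_filtP (V : vectType K) (pi : grading P V) (a : downset P) v :
  reflect (forall p, p \notin a -> pi p v = 0) (v \in grading_filt pi a).
Proof.
apply: (iffP idP) => [/memv_sumP[u ua ->] p pa | H].
  rewrite linear_sum big1 //= => q qa.
  have /memv_imgP[w _ ->] := ua q qa.
  rewrite -comp_lfunE gproj_orth ?zero_lfunE //.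
  by apply: contraNneq pa => ->.
have -> : v = \sum_(p in a) pi p v.
  rewrite -[LHS](id_lfunE v) -(gproj_sum pi) sum_lfunE /=.
  by rewrite (bigID (mem a)) /= [X in _ + X]big1 ?addr0.
by apply: memv_sumr => p _; rewrite memv_img // memvf.
Qed.

Lemma grading_filt_hom (V : vectType K) (pi : grading P V) :
  is_subspace_lattice_hom (grading_filt pi).
Proof.
split=> [||a b|a b].
- by rewrite /grading_filt big_pred0 // => p; rewrite in_downset0.
- apply/vspaceP => v; rewrite memvf; apply/grading_filtP => p.
  by rewrite in_downset1.
- apply/vspaceP => v; rewrite memv_cap.
  apply/grading_filtP/andP => [H|[/grading_filtP H1 /grading_filtP H2] p].
    by split; apply/grading_filtP => p pa; apply: H;
      rewrite in_downsetI negb_and pa ?orbT.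
  by rewrite in_downsetI negb_and => /orP[/H1|/H2].
- apply/eqP; rewrite eqEsubv; apply/andP; split.
    apply/subv_sumP => p; rewrite in_downsetU => /orP[pa|pb].
      by apply: subv_trans (addvSl _ _); rewrite /grading_filt (sumv_sup p).
    by apply: subv_trans (addvSr _ _); rewrite /grading_filt (sumv_sup p).
  rewrite subv_add; apply/andP; split; apply/subv_sumP => p pa;
    by rewrite /grading_filt (sumv_sup p) // in_downsetU pa ?orbT.
Qed.

Lemma graded_filtered_filt (V W : vectType K) (piV : grading P V)
    (piW : grading P W) (phi : 'Hom(V, W)) (a : downset P) :
  graded_filtered piV piW phi ->
  (phi @: grading_filt piV a <= grading_filt piW a)%VS.
Proof.
move=> H; rewrite limg_sum; apply/subv_sumP => q qa.
apply/subvP => _ /memv_imgP[_ /memv_imgP[v _ ->] ->].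
apply/grading_filtP => p pa; rewrite -!comp_lfunE.
have [->|/H pq] := eqVneq (piW p \o phi \o piV q)%VF 0.
  by rewrite zero_lfunE.
by rewrite (downset_le qa pq) in pa.
Qed.

Definition graded_to_filtered (C : graded_complex P K) :
    filtered_complex (downset P) K :=
  @FilteredComplex _ (downset P) K C (fun n => grading_filt (gpi C n))
    (fun n => grading_filt_hom (gpi C n))
    (fun n a => graded_filtered_filt a (@gbnd_filtered _ _ _ C n)).

Definition filtered_conley_complex (C : filtered_complex (downset P) K)
    (C' : graded_complex P K) : Prop :=
  strict C' /\ filtered_chain_equivalent (graded_to_filtered C') C.

End DownsetFiltering.

Record cell_complex dX (K : fieldType) := CellComplex {
  cell :> finPOrderType dX;
  cell_dim : cell -> nat;
  cell_dim_homo : forall x y : cell, (x <= y)%O -> (cell_dim x <= cell_dim y)%N;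
  kappa : cell -> cell -> K;
  kappa_le : forall x y, kappa x y != 0 -> (y <= x)%O;
  kappa_dim : forall x y, kappa x y != 0 -> cell_dim x = (cell_dim y + 1)%N;
  kappa_kappa : forall x z, \sum_y kappa x y * kappa y z = 0
}.

Record graded_cell_complex d dX (P : finPOrderType d) (K : fieldType) :=
  GradedCellComplex {
    gcells :> cell_complex dX K;
    cell_grade : gcells -> P;
    cell_grade_homo : {homo cell_grade : x y / (x <= y)%O}
  }.

Section CellChains.
Context {dX : Order.disp_t} {K : fieldType} (X : cell_complex dX K).

(* Empty for negative [n]. *)
Definition ncell (n : int) : finType := {x : X | (cell_dim x)%:Z == n}.

Definition cell_chain (n : int) : vectType K := {ffun ncell n -> K^o}.

Definition cell_vec n (x : ncell n) : cell_chain n := [ffun y => (y == x)%:R].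

Lemma cell_chain_expand n (c : cell_chain n) : c = \sum_x c x *: cell_vec x.
Proof.
apply/ffunP => y; rewrite sum_ffunE (bigD1 y) //= big1 => [|x xy].
  by rewrite !ffunE eqxx addr0 [RHS]mulr1.
by rewrite !ffunE eq_sym (negPf xy) [LHS]mulr0.
Qed.

Definition cell_bnd_fun n (c : cell_chain (n + 1)) : cell_chain n :=
  \sum_(x : ncell (n + 1)) c x *:
    \sum_(y : ncell n) kappa (val x) (val y) *: cell_vec y.

Fact cell_bnd_fun_linear n : linear (@cell_bnd_fun n).
Proof.
move=> k c c'; rewrite /cell_bnd_fun scaler_sumr -big_split /=.
by apply: eq_bigr => x _; rewrite !ffunE scalerDl scalerA.
Qed.

HB.instance Definition _ n :=
  GRing.isLinear.Build K (cell_chain (n + 1)) (cell_chain n) _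
    (@cell_bnd_fun n) (@cell_bnd_fun_linear n).

Definition cell_bnd n : 'Hom(cell_chain (n + 1), cell_chain n) :=
  linfun (@cell_bnd_fun n).

Lemma cell_bndE n (c : cell_chain (n + 1)) (y : ncell n) :
  cell_bnd n c y = \sum_(x : ncell (n + 1)) c x * kappa (val x) (val y).
Proof.
rewrite lfunE /= /cell_bnd_fun sum_ffunE; apply: eq_bigr => x _.
rewrite !ffunE sum_ffunE (bigD1 y) //= big1 => [|z zy].
  by rewrite !ffunE eqxx addr0 [X in _ *: X]mulr1.
by rewrite !ffunE eq_sym (negPf zy) [LHS]mulr0.
Qed.

Lemma cell_bnd_bnd n : (cell_bnd n \o cell_bnd (n + 1) = 0)%VF.
Proof.
apply/lfunP => c; rewrite comp_lfunE zero_lfunE; apply/ffunP => z.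
rewrite cell_bndE [RHS]ffunE.
under eq_bigr => y _ do rewrite cell_bndE mulr_suml.
rewrite exchange_big big1 //= => x _.
under eq_bigr => y _ do rewrite -mulrA.
rewrite -mulr_sumr; apply: (etrans _ (mulr0 (c x))); congr (_ * _).
apply: (etrans _ (kappa_kappa (val x) (val z))).
rewrite [RHS](bigID (fun y => (cell_dim y)%:Z == n + 1)) /= [X in _ = _ + X]big1.
  rewrite addr0.
  rewrite [RHS](reindex_omap (val : ncell (n + 1) -> X) insub) /=.
    by apply: eq_bigl => y; rewrite (valP y) valK eqxx.
  by move=> y yn; rewrite insubT.
move=> y yn; have [->|/kappa_dim yz] := eqVneq (kappa y (val z)) 0.
  by rewrite mulr0.
by case/negP: yn; rewrite yz PoszD (eqP (valP z)).
Qed.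

Definition cell_chain_complex : chain_complex K := ChainComplex cell_bnd_bnd.

End CellChains.

Section GradedCellChains.
Context {d dX : Order.disp_t} {P : finPOrderType d} {K : fieldType}.
Variable X : graded_cell_complex dX P K.
Local Notation C := (cell_chain X).

Definition cell_proj_fun n (p : P) (c : C n) : C n :=
  \sum_(x : ncell X n | cell_grade (val x) == p) c x *: cell_vec x.

Fact cell_proj_fun_linear n p : linear (@cell_proj_fun n p).
Proof.
move=> k c c'; rewrite /cell_proj_fun scaler_sumr -big_split /=.
by apply: eq_bigr => x _; rewrite !ffunE scalerDl scalerA.
Qed.

HB.instance Definition _ n p :=
  GRing.isLinear.Build K (C n) (C n) _
    (@cell_proj_fun n p) (@cell_proj_fun_linear n p).

Definition cell_proj n (p : P) : 'End(C n) := linfun (@cell_proj_fun n p).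

Lemma cell_projE n p (c : C n) (y : ncell X n) :
  cell_proj n p c y = if cell_grade (val y) == p then c y else 0.
Proof.
rewrite lfunE /= /cell_proj_fun sum_ffunE; case: ifP => yp.
  rewrite (bigD1 y) //= big1 => [|x /andP[_ xy]].
    by rewrite !ffunE eqxx addr0 [LHS]mulr1.
  by rewrite !ffunE eq_sym (negPf xy) [LHS]mulr0.
rewrite big1 // => x xp; rewrite !ffunE.
have [yx|_] := eqVneq y x; last exact: mulr0.
by rewrite yx xp in yp.
Qed.

Lemma cell_proj_idem n p : (cell_proj n p \o cell_proj n p = cell_proj n p)%VF.
Proof.
apply/lfunP => c; apply/ffunP => y; rewrite comp_lfunE !cell_projE.
by case: eqP.
Qed.

Lemma cell_proj_sum n : \sum_p cell_proj n p = \1%VF.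
Proof.
apply/lfunP => c; apply/ffunP => y; rewrite id_lfunE sum_lfunE sum_ffunE.
rewrite (bigD1 (cell_grade (val y))) //= cell_projE eqxx big1 ?addr0 // => p py.
by rewrite cell_projE eq_sym (negPf py).
Qed.

Lemma cell_proj_orth n p q :
  p != q -> (cell_proj n p \o cell_proj n q = 0)%VF.
Proof.
move=> pq; apply/lfunP => c; apply/ffunP => y.
rewrite comp_lfunE zero_lfunE !cell_projE [RHS]ffunE.
by case: eqP => // ->; rewrite (negPf pq).
Qed.

Definition cell_grading n : grading P (C n) :=
  Grading (@cell_proj_idem n) (cell_proj_sum n) (@cell_proj_orth n).

Lemma cell_bnd_filtered n :
  graded_filtered (cell_grading (n + 1)) (cell_grading n)
    (bnd (cell_chain_complex X) n).
Proof.
move=> p q; apply: contraNT => pq; apply/eqP/lfunP => c; apply/ffunP => y.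
rewrite !comp_lfunE zero_lfunE [RHS]ffunE /= cell_projE.
case: eqP => // yp; rewrite cell_bndE big1 // => x _.
rewrite cell_projE; case: eqP => [xq|_]; last by rewrite mul0r.
have [->|/kappa_le /cell_grade_homo] := eqVneq (kappa (val x) (val y)) 0.
  by rewrite mulr0.
by rewrite yp xq (negPf pq).
Qed.

Definition cell_graded_complex : graded_complex P K :=
  @GradedComplex _ P K (cell_chain_complex X) cell_grading cell_bnd_filtered.

Definition cell_filt n (a : downset P) : {vspace C n} :=
  <<[seq cell_vec x | x in [pred x : ncell X n | cell_grade (val x) \in a]]>>%VS.

Lemma cell_filtE n (a : downset P) :
  cell_filt n a = grading_filt (cell_grading n) a.
Proof.
apply/eqP; rewrite eqEsubv; apply/andP; split.
  apply/span_subvP => _ /imageP[x xa ->]; rewrite inE in xa.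
  apply/grading_filtP => p pa; apply/ffunP => y.
  rewrite cell_projE !ffunE; case: eqP => // yp.
  have [yx|//] := eqVneq y x.
  by rewrite -yp yx xa in pa.
apply/subvP => c /grading_filtP H; rewrite [c]cell_chain_expand.
apply: memv_suml => x _.
have [xa|xa] := boolP (cell_grade (val x) \in a).
  by rewrite rpredZ // memv_span //; apply: image_f.
have := congr1 (fun f : C n => f x) (H _ xa).
by rewrite /= cell_projE eqxx ffunE => ->; rewrite scale0r mem0v.
Qed.

Lemma cell_filt_hom n : is_subspace_lattice_hom (cell_filt n).
Proof.
have [H0 H1 HI HU] := grading_filt_hom (cell_grading n).
by split=> *; rewrite !cell_filtE.
Qed.

Lemma cell_filt_bnd n (a : downset P) :
  (bnd (cell_chain_complex X) n @: cell_filt (n + 1) a <= cell_filt n a)%VS.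
Proof. by rewrite !cell_filtE; apply/graded_filtered_filt/cell_bnd_filtered. Qed.

Definition cell_filtered_complex : filtered_complex (downset P) K :=
  @FilteredComplex _ (downset P) K (cell_chain_complex X) cell_filt
    cell_filt_hom cell_filt_bnd.

End GradedCellChains.

(* Main.v *)
Require Import Defs.
From mathcomp Require Import all_boot all_order all_algebra.

(** Both notions of Conley complex ask for the same strictness, and both ask
    for chain maps and homotopies between the same chain complexes; only the
    meaning of filtered differs. A P-filtered map sends the graded piece over q
    into the sum of the pieces over the elements below q, so it sends the sum
    of the pieces over a down-set into the sum of the pieces over the same
    down-set ([graded_filtered_filt]). Hence the maps of a P-filtered
    equivalence are themselves the maps of an O(P)-filtered one
    ([graded_chain_equivalent_filtered]). On cellular chains, the span of the
    cells graded in a down-set is the sum of the graded pieces over that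
    down-set ([cell_filtE]), so the filtering by spans of cells is the one that
    the grading induces. *)

Lemma graded_chain_equivalent_filtered (d : Order.disp_t)
    (P : finPOrderType d) (K : fieldType) (C D : graded_complex P K) :
  graded_chain_equivalent C D ->
  filtered_chain_equivalent (graded_to_filtered C) (graded_to_filtered D).
Proof.
move=> [phi [psi [g [h [[phiC phiF] [psiC psiF] [gH gF] [hH hF]]]]]].
exists phi, psi, g, h.
by split; split=> // n a; apply: graded_filtered_filt.
Qed.

Theorem theorem7p18 (dP dX : Order.disp_t) (P : finPOrderType dP)
    (K : fieldType) (X : graded_cell_complex dX P K)
    (C' : graded_complex P K) :
  graded_conley_complex (cell_graded_complex X) C' ->
  filtered_conley_complex (cell_filtered_complex X) C'.
Proof.
move=> [C'strict /graded_chain_equivalent_filtered].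
move=> [phi [psi [g [h [[phiC phiF] [psiC psiF] [gH gF] [hH hF]]]]]].
split=> //; exists phi, psi, g, h.
(* The two filterings of the cellular chains agree only up to [cell_filtE], so
   the filtered conditions are transported value by value. *)
split; split=> // n a; rewrite /= ?cell_filtE.
- exact: phiF.
- exact: psiF.
- exact: hF.
Qed.
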